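(* Let $D$ be a complete division ring of characteristic $0$, and let $p_n(x)=a_0xa_1x\cdots xa_n$ ($a_0,\dots,a_n\in D$) be a monomial of power $n$ in one variable over $D$. If $m<n$, then $$\partial^mp_n(0)(h)=0$$ for all $h\in D$.
   Context: A complete division ring of characteristic $0$ is a division ring $D$ of characteristic $0$ with an absolute value $|\cdot|:D\to\mathbb R$ ($|a|\ge0$, $|a|=0$ iff $a=0$, $|ab|=|a||b|$, $|a+b|\le|a|+|b|$), complete for the metric $|a-b|$, such that the embedding of the rational field $\mathbb Q$ (usual topology) into $D$ is a homeomorphism onto its image; then $\mathbb R$ is a subfield of the center $Z(D)$. A map $f:D\to D$ is differentiable in the Gâteaux sense if at every $x$ one has $f(x+a)-f(x)=\partial f(x)(a)+o(a)$, where $a\mapsto\partial f(x)(a)$ is linear (additive and homogeneous over $Z(D)$) and $o$ is a continuous map with $|o(a)|/|a|\to0$ as $a\to0$; then $\partial f(x)(a)=\lim_{t\to0,\,t\in\mathbb R}t^{-1}(f(x+ta)-f(x))$. Higher derivatives: $\partial^0f(x)=f(x)$ and $\partial^nf(x)(h_1;\dots;h_n)=\partial\big(\partial^{n-1}f(x)(h_1;\dots;h_{n-1})\big)(h_n)$, the outer $\partial$ being taken with respect to $x$. Notation: $\partial^mf(x)(h)=\partial^mf(x)(h;\dots;h)$ ($m$ copies of $h$). *)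

(* Defs.v *)
From HB Require Import structures.
From mathcomp Require Import all_boot all_order all_algebra.
From mathcomp Require Import all_classical all_reals.
From mathcomp Require Import topology normedtype.

Set Implicit Arguments.
Unset Strict Implicit.
Unset Printing Implicit Defensive.

Import Order.TTheory GRing.Theory Num.Theory.
Import numFieldNormedType.Exports.

Local Open Scope classical_set_scope.
Local Open Scope ring_scope.

(* [absv] is not a MathComp norm: a [normedZmodType] norm satisfies
   [`|x *+ n| = `|x| *+ n], whereas absolute values such as |x|^(1/2) on the
   reals are allowed here. The last two fields say that [ratr], which is
   injective in characteristic 0, is a homeomorphism from the rationals with
   their usual topology (carried by [rat^o]) onto its image. *)
HB.mixin Record isCompleteDivRing (R : realType) D
    & GRing.UnitRing D & Uniform D := {
  divring_unit : forall x : D, x != 0 -> x \is a GRing.unit;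
  divring_pchar0 : [pchar D] =i pred0;
  absv : D -> R;
  absv_ge0 : forall x : D, 0 <= absv x;
  absv_eq0 : forall x : D, absv x = 0 <-> x = 0;
  absvM : forall x y : D, absv (x * y) = absv x * absv y;
  ler_absvD : forall x y : D, absv (x + y) <= absv x + absv y;
  entourage_absv : (entourage : set_system (D * D)) =
    entourage_ (fun (x : D) (e : R) => [set y | absv (x - y) < e]);
  divring_complete : forall F : set_system D,
    ProperFilter F -> cauchy F -> exists x : D, F --> x;
  ratr_continuous : continuous (ratr : rat^o -> D);
  ratr_open_image : forall A : set rat^o, open A ->
    exists2 B : set D, open B & ratr @` A = B `&` range (ratr : rat -> D)
}.

#[short(type="completeDivRingType")]
HB.structure Definition CompleteDivRing (R : realType) :=
  { D of GRing.UnitRing D & Uniform D & isCompleteDivRing R D }.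

Definition central (D : pzRingType) (c : D) : Prop := forall y : D, c * y = y * c.

Definition center_linear (D : pzRingType) (L : D -> D) : Prop :=
  (forall a b, L (a + b) = L a + L b) /\
  (forall c a, central c -> L (c * a) = c * L a).

Definition is_gateaux_derivative (R : realType) (D : completeDivRingType R)
    (f : D -> D) (x : D) (L : D -> D) : Prop :=
  center_linear L /\
  exists o : D -> D,
    [/\ continuous o,
        forall a, f (x + a) - f x = L a + o a
      & (absv (o a) / absv a : R) @[a --> (0 : D)^'] --> (0 : R)].

Definition gateaux_differentiable (R : realType) (D : completeDivRingType R)
    (f : D -> D) : Prop :=
  forall x, exists L, is_gateaux_derivative f x L.

(* [gateaux f x a] is meaningful only where [f] has a derivative: elsewhere
   [xget] returns the null map. *)
Definition gateaux (R : realType) (D : completeDivRingType R)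
    (f : D -> D) (x : D) : D -> D :=
  xget (fun=> 0) [set L | is_gateaux_derivative f x L].

(* The increments are listed in order of differentiation:
   [gateauxn f [:: h1; ...; hn] x] differentiates along h1 first. *)
Definition gateauxn (R : realType) (D : completeDivRingType R)
    (f : D -> D) (hs : seq D) : D -> D :=
  foldl (fun g h x => gateaux g x h) f hs.

Definition gateaux_differentiablen (R : realType) (D : completeDivRingType R)
    (m : nat) (f : D -> D) : Prop :=
  forall hs : seq D, (size hs < m)%N -> gateaux_differentiable (gateauxn f hs).

Definition monomial (D : pzRingType) (n : nat) (a : 'I_n.+1 -> D) (x : D) : D :=
  a ord0 * \prod_(i < n) (x * a (lift ord0 i)).

(* Main.v *)
Require Import Defs.
From HB Require Import structures.
From mathcomp Require Import all_boot all_order all_algebra.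
From mathcomp Require Import all_classical all_reals.
From mathcomp Require Import topology normedtype.

(** Differentiating a product [f * g] along [h] gives [df h * g + f * dg h],
    and the increment of the identity is [h], a constant. So each
    differentiation of a noncommutative monomial replaces one occurrence of the
    variable by a constant: after fewer than [n] differentiations, what is left
    of [a0 x a1 x ... x an] is a sum of products in which the variable still
    occurs, and it vanishes at [0].

    The bookkeeping is done on the maps [polymap k], the sums of noncommutative
    monomials with at least [k] occurrences of the variable. By induction on
    their construction they are differentiable, and the derivative along a
    fixed increment is in [polymap k.-1] ([polymap_derivative]); those with
    [0 < k] vanish at [0] ([polymap_at0]).

    The analysis lies in two facts. The Leibniz rule
    ([bounded_gateaux_derivativeM]) has a remainder containing the term
    [L a * (g (x + a) - g x)], which is small compared with [a] only if the
    derivative [L] is bounded; hence boundedness is carried along the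
    induction. And derivatives are unique ([is_gateaux_derivative_unique]), so
    that the chosen value [gateaux f x] is the one computed by the rules: for a
    center-linear [M], the ratio of [absv (M a)] to [absv a] is the same at all
    nonzero rational multiples of [a], which accumulate at [0] because the
    rationals keep their usual topology inside [D]; so [M] vanishes if it is
    [o(a)]. *)

Local Open Scope ring_scope.

Set Implicit Arguments.
Unset Strict Implicit.
Unset Printing Implicit Defensive.

Import Order.TTheory GRing.Theory Num.Theory.
Import numFieldNormedType.Exports.

Local Open Scope classical_set_scope.

(** * The topology of a complete division ring *)

Section AbsoluteValue.
Context {R : realType} {D : completeDivRingType R}.
Implicit Types x y z : D.

Lemma absv0 : absv (0 : D) = 0.
Proof. by apply/absv_eq0. Qed.

Lemma absv_neq0 x : x != 0 -> absv x != 0.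
Proof. by apply: contra_neq => /absv_eq0. Qed.

Lemma absv_gt0 x : x != 0 -> 0 < absv x.
Proof. by move=> x0; rewrite lt_def absv_neq0 // absv_ge0. Qed.

Lemma absv1 : absv (1 : D) = 1.
Proof.
apply: (mulIf (absv_neq0 (oner_neq0 D))).
by rewrite -absvM mulr1 mul1r.
Qed.

Lemma absvN x : absv (- x) = absv x.
Proof.
suff -> : absv (- x) = absv (-1 : D) * absv x.
  suff -> : absv (-1 : D) = 1 by rewrite mul1r.
  apply/eqP; rewrite -(@eqrXn2 _ 2) ?absv_ge0 ?ler01 //.
  by rewrite expr2 -absvM mulrNN mulr1 absv1 expr1n.
by rewrite -absvM mulN1r.
Qed.

Lemma absvBC x y : absv (x - y) = absv (y - x).
Proof. by rewrite -absvN opprB. Qed.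

Lemma ler_dist_absv x y : `|absv x - absv y| <= absv (x - y).
Proof.
rewrite ler_norml; apply/andP; split.
  rewrite lerNl opprB lerBlDr absvBC.
  by rewrite -[X in absv X <= _](subrK x) ler_absvD.
by rewrite lerBlDr -[X in absv X <= _](subrK y) ler_absvD.
Qed.

Lemma mulr_neq0_absv x y : x != 0 -> y != 0 -> x * y != 0.
Proof.
move=> x0 y0; apply/eqP => /absv_eq0/eqP.
by rewrite absvM mulf_eq0 (negbTE (absv_neq0 x0)) (negbTE (absv_neq0 y0)).
Qed.

(** Characteristic [0] only speaks of primes; the general case peels off the
    prime factors of [n] one at a time. *)
Lemma natr_neq0 n : (0 < n)%N -> n%:R != 0 :> D.
Proof.
elim/ltn_ind: n => n IH n0; have [n1|n1] := leqP n 1.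
  by rewrite (_ : n = 1)%N ?oner_neq0 //; apply/eqP; rewrite eqn_leq n1.
have pr := pdiv_prime n1.
rewrite -(divnK (pdiv_dvd n)) natrM mulr_neq0_absv //.
  apply: IH; first by rewrite ltn_Pdiv // prime_gt1.
  by rewrite divn_gt0 ?pdiv_gt0 // dvdn_leq ?pdiv_dvd.
apply/negP => p0; have := divring_pchar0 (s := D) (pdiv n).
by rewrite !inE pr p0.
Qed.

Lemma intr_neq0 (z : int) : z != 0 -> z%:~R != 0 :> D.
Proof.
case: z => [[|n]|n] // _; first exact: natr_neq0.
by rewrite NegzE mulrNz oppr_eq0; exact: natr_neq0.
Qed.

Lemma ratr_neq0 (q : rat) : q != 0 -> ratr q != 0 :> D.
Proof.
move=> q0; apply: mulr_neq0_absv; first by rewrite intr_neq0 // numq_eq0.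
by rewrite invr_eq0 intr_neq0 // denq_eq0.
Qed.

Lemma ratr_central (q : rat) : central (ratr q : D).
Proof.
by move=> y; exact/esym/(commrM (commr_int y _))/commrV/commr_int.
Qed.

Lemma nbhs_absv x (A : set D) :
  nbhs x A <-> exists2 e : R, 0 < e & forall y, absv (x - y) < e -> A y.
Proof.
rewrite -nbhs_entourageE /nbhs_ /=; split.
  case=> E; rewrite entourage_absv => -[e /= e0 eE] EA.
  exists e => // y xy; apply: EA; rewrite /xsection /= inE.
  by apply: eE.
case=> e e0 eA; exists [set xy : D * D | absv (xy.1 - xy.2) < e].
  by rewrite entourage_absv; exists e.
by move=> y; rewrite /xsection /= inE; exact: eA.
Qed.

(** Limits in [D] become limits of real-valued functions, to which the squeeze
    theorem applies. *)
Lemma cvg_absvP {T : Type} {F : set_system T} {FF : Filter F} (f : T -> D) l :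
  f @ F --> l <-> absv (l - f t) @[t --> F] --> (0 : R).
Proof.
split.
  move=> fl; apply/cvgr0Pnorm_lt => e e0.
  have : nbhs l [set y | absv (l - y) < e] by apply/nbhs_absv; exists e.
  move=> /fl; apply: (@filterS _ F) => t /=.
  by rewrite ger0_norm ?absv_ge0.
move=> /cvgr0Pnorm_lt fl A /nbhs_absv[e e0 eA].
apply: (@filterS _ F _ _ (f @^-1` A) _ (fl e e0)) => t /=.
by rewrite ger0_norm ?absv_ge0 //; exact: eA.
Qed.

Lemma cvg_absv {T : Type} {F : set_system T} {FF : Filter F} (f : T -> D) l :
  f @ F --> l -> absv (f t) @[t --> F] --> absv l.
Proof.
move=> /cvg_absvP/cvgr0Pnorm_lt fl; apply/cvgrPdist_lt => e /fl.
apply: filterS => t; rewrite ger0_norm ?absv_ge0 //.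
exact/le_lt_trans/ler_dist_absv.
Qed.

Lemma cvg_divringD {T : Type} {F : set_system T} {FF : Filter F}
    (f g : T -> D) a b :
  f @ F --> a -> g @ F --> b -> f t + g t @[t --> F] --> a + b.
Proof.
move=> /cvg_absvP fa /cvg_absvP gb; apply/cvg_absvP.
apply: (squeeze_cvgr (f := fun=> 0)
  (h := fun t => absv (a - f t) + absv (b - g t))).
- apply: nearW => t; rewrite absv_ge0 /=.
  by rewrite opprD addrACA ler_absvD.
- exact: cvg_cst.
- by rewrite -[X in _ --> X](addr0 0); apply: cvgD.
Qed.

Lemma cvg_divringM {T : Type} {F : set_system T} {FF : Filter F}
    (f g : T -> D) a b :
  f @ F --> a -> g @ F --> b -> f t * g t @[t --> F] --> a * b.
Proof.
move=> fa gb; have /cvg_absvP fa0 := fa; have /cvg_absvP gb0 := gb.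
apply/cvg_absvP; apply: (squeeze_cvgr (f := fun=> 0) (h := fun t =>
  absv (a - f t) * absv b + absv (f t) * absv (b - g t))).
- apply: nearW => t; rewrite absv_ge0 /= -!absvM.
  apply: le_trans (ler_absvD _ _).
  by rewrite mulrBl mulrBr addrA subrK.
- exact: cvg_cst.
- rewrite -[X in _ --> X](addr0 0); apply: cvgD.
    by rewrite -[X in _ --> X](mul0r (absv b)); apply: cvgMl.
  rewrite -[X in _ --> X](mulr0 (absv a)); apply: cvgM => //.
  exact: cvg_absv.
Qed.

(** Rational scalars are central, and continuity of the embedding of the
    rationals at [0] makes some of them small. The absolute value need not be
    homogeneous over the rationals (it may be a power of the usual one), so the
    size of [c] cannot be read off the rational it comes from. *)
Lemma small_central (e : R) : 0 < e ->
  exists c : D, [/\ central c, c != 0 & absv c < e].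
Proof.
move=> e0.
have : nbhs (ratr (0 : rat) : D) [set y | absv (ratr 0 - y) < e].
  by apply/nbhs_absv; exists e.
move=> /(ratr_continuous (s := D) (0 : rat^o)) /nbhs_ballP[d /= d0 dA].
have d2 : 0 < d / 2 by rewrite divr_gt0.
exists (ratr (d / 2)); split; first exact: ratr_central.
  by rewrite ratr_neq0 // gt_eqF.
have : ball (0 : rat^o) d (d / 2).
  rewrite /ball /= sub0r normrN gtr0_norm //.
  by rewrite ltr_pdivrMr // ltr_pMr // ltr1n.
move=> /dA /=; rewrite [X in X - _](_ : _ = 0) ?sub0r ?absvN //.
exact: ratr_nat _ 0%N.
Qed.

End AbsoluteValue.

(** * Uniqueness and calculus of Gateaux derivatives *)

Section Derivative.
Context {R : realType} {D : completeDivRingType R}.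
Implicit Types (f g L M : D -> D) (x a : D).

(** Multiplying [a] by a central [c] leaves [absv (M a) / absv a] unchanged,
    and [c * a] can be brought arbitrarily close to [0]: the ratio equals its
    limit [0]. *)
Lemma center_linear_littleo0 M : center_linear M ->
  (absv (M a) / absv a : R) @[a --> (0 : D)^'] --> (0 : R) -> M =1 fun=> 0.
Proof.
move=> [Madd Mlin] M0 a; have [->|a0] := eqVneq a 0.
  by apply: (addrI (M 0)); rewrite -Madd !addr0.
apply/absv_eq0/eqP; rewrite -[_ == 0]negbK; apply/negP => Ma0.
have r0 : 0 < absv (M a) / absv a.
  by rewrite divr_gt0 ?(absv_gt0 a0) // lt_def Ma0 absv_ge0.
move/cvgr0Pnorm_lt/(_ _ r0): M0 => /nbhs_absv[e e0].
have [c [cc c0 ce]] := small_central (D := D) (divr_gt0 e0 (absv_gt0 a0)).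
move=> /(_ (c * a)); rewrite sub0r absvN absvM -ltr_pdivlMr ?absv_gt0 //.
move=> /(_ ce) /(_ (mulr_neq0_absv c0 a0)).
rewrite Mlin // !absvM -mulf_div divff ?absv_neq0 // mul1r.
by rewrite gtr0_norm // ltxx.
Qed.

Lemma is_gateaux_derivative_unique f x L M :
  is_gateaux_derivative f x L -> is_gateaux_derivative f x M -> L = M.
Proof.
move=> [[Ladd Lh] [o [_ fo o0]]] [[Madd Mh] [p [_ fp p0]]].
have LM a : L a - M a = p a - o a.
  apply/eqP; rewrite subr_eq addrAC -subr_eq opprK -fo fp.
  by rewrite [M a + _]addrC.
apply/funext => a; apply/eqP; rewrite -subr_eq0; apply/eqP; move: a.
apply: center_linear_littleo0.
  split=> [a b|c a cc]; first by rewrite Ladd Madd opprD addrACA.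
  by rewrite Lh // Mh // mulrBr.
apply: (squeeze_cvgr (f := fun=> 0) (h := fun a =>
  absv (p a) / absv a + absv (o a) / absv a)).
- apply: nearW => a; rewrite divr_ge0 ?absv_ge0 //= LM -mulrDl.
  rewrite ler_wpM2r ?invr_ge0 ?absv_ge0 //.
  by rewrite -[absv (o a)]absvN ler_absvD.
- exact: cvg_cst.
- by rewrite -[X in _ --> X](addr0 0); apply: cvgD.
Qed.

Lemma gateaux_eq f x L : is_gateaux_derivative f x L -> gateaux f x = L.
Proof.
move=> fL; apply: xget_unique => // M fM.
exact: is_gateaux_derivative_unique fM fL.
Qed.

(** The bound is the part of the induction hypothesis that makes the remainder
    in the Leibniz rule small; stated with the derivative, it passes through
    sums and products together with it. *)
Definition bounded_gateaux_derivative f x L :=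
  is_gateaux_derivative f x L /\
  exists C : R, forall a, absv (L a) <= C * absv a.

Lemma center_linear_bounded_continuous L (C : R) : center_linear L ->
  (forall a, absv (L a) <= C * absv a) -> continuous L.
Proof.
move=> [Ladd _] LC x; apply/cvg_absvP.
have LB a b : L (a - b) = L a - L b.
  by apply: (addIr (L b)); rewrite -Ladd !subrK.
apply: (squeeze_cvgr (f := fun=> 0) (h := fun a => C * absv (x - a))).
- by apply: nearW => a; rewrite absv_ge0 -LB LC.
- exact: cvg_cst.
- rewrite -[X in _ --> X](mulr0 C); apply: cvgMr.
  exact/cvg_absvP.
Qed.

Lemma bounded_gateaux_derivative_cst c x :
  bounded_gateaux_derivative (fun=> c) x (fun=> 0).
Proof.
split; last by exists 0 => a; rewrite absv0 mul0r.
split; first by split=> *; rewrite ?mulr0 ?addr0.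
exists (fun=> 0); split => [|a|]; first exact: cst_continuous.
  by rewrite addr0 subrr.
under eq_fun do rewrite absv0 mul0r.
exact: cvg_cst.
Qed.

Lemma bounded_gateaux_derivative_id x : bounded_gateaux_derivative id x id.
Proof.
split; last by exists 1 => a; rewrite mul1r.
split=> //; exists (fun=> 0); split => [|a|]; first exact: cst_continuous.
  by rewrite addr0 addrC addKr.
under eq_fun do rewrite absv0 mul0r.
exact: cvg_cst.
Qed.

Lemma bounded_gateaux_derivativeD f g x L M :
  bounded_gateaux_derivative f x L -> bounded_gateaux_derivative g x M ->
  bounded_gateaux_derivative (fun y => f y + g y) x (fun a => L a + M a).
Proof.
move=> [[[Ladd Lh] [o [oc fo o0]]] [C LC]] [[[Madd Mh] [p [pc gp p0]]] [B MB]].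
split; last first.
  exists (C + B) => a; rewrite mulrDl.
  by apply: le_trans (ler_absvD _ _) _; rewrite lerD.
split.
  split=> [a b|c a cc]; first by rewrite Ladd Madd addrACA.
  by rewrite Lh // Mh // mulrDr.
exists (fun a => o a + p a); split=> [a|a|].
- by apply: cvg_divringD; [exact: oc | exact: pc].
- by rewrite opprD addrACA fo gp addrACA.
apply: (squeeze_cvgr (f := fun=> 0) (h := fun a =>
  absv (o a) / absv a + absv (p a) / absv a)).
- apply: nearW => a; rewrite divr_ge0 ?absv_ge0 //= -mulrDl.
  by rewrite ler_wpM2r ?invr_ge0 ?absv_ge0 // ler_absvD.
- exact: cvg_cst.
- by rewrite -[X in _ --> X](addr0 0); apply: cvgD.
Qed.

(** Leibniz rule. Expanding [f (x + a) * g (x + a)] leaves the remainder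
    [L a * (g (x + a) - g x) + o a * g (x + a) + f x * p a], with [o] and [p]
    the remainders of [f] and [g]; the first term is [o(a)] since [L] is bounded
    and [g] is continuous. *)
Lemma bounded_gateaux_derivativeM f g x L M : continuous g ->
  bounded_gateaux_derivative f x L -> bounded_gateaux_derivative g x M ->
  bounded_gateaux_derivative (fun y => f y * g y) x
    (fun a => L a * g x + f x * M a).
Proof.
move=> gc [[lL [o [oc fo o0]]] [C LC]] [[[Madd Mh] [p [pc gp p0]]] [B MB]].
have [Ladd Lh] := lL; split; last first.
  exists (C * absv (g x) + absv (f x) * B) => a; rewrite mulrDl.
  apply: le_trans (ler_absvD _ _) _; rewrite lerD // absvM.
    by rewrite mulrAC ler_wpM2r ?absv_ge0.
  by rewrite -mulrA ler_wpM2l ?absv_ge0.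
split.
  split=> [a b|c a cc].
    by rewrite Ladd Madd mulrDl mulrDr addrACA.
  by rewrite Lh // Mh // mulrDr !mulrA -(cc (f x)).
have gxc b : g (x + a) @[a --> b] --> g (x + b).
  apply: (@cvg_comp _ _ _ (fun a => x + a) g _ (nbhs (x + b))); last exact: gc.
  by apply: cvg_divringD; [exact: cvg_cst | exact: cvg_id].
have gx0 : g (x + a) @[a --> (0 : D)^'] --> g x.
  have := gxc 0; rewrite addr0.
  by apply: cvg_trans; apply: cvg_app; exact: cvg_within.
exists (fun a => L a * (g (x + a) - g x) + (o a * g (x + a) + f x * p a)).
split=> [a|a|].
- apply: cvg_divringD.
    apply: cvg_divringM.
      exact: center_linear_bounded_continuous lL LC a.
    by apply: cvg_divringD; [exact: gxc | exact: cvg_cst].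
  apply: cvg_divringD; apply: cvg_divringM; [exact: oc | exact: gxc | |].
    exact: cvg_cst.
  exact: pc.
- have -> : L a * g x + f x * M a +
      (L a * (g (x + a) - g x) + (o a * g (x + a) + f x * p a)) =
      (L a + o a) * g (x + a) + f x * (M a + p a).
    rewrite addrACA -mulrDr [g x + _]addrC subrK.
    by rewrite [f x * M a + _]addrCA addrA -mulrDl -mulrDr.
  by rewrite -fo -gp mulrBl mulrBr addrA subrK.
apply: (squeeze_cvgr (f := fun=> 0) (h := fun a =>
  C * absv (g x - g (x + a)) + (absv (o a) / absv a * absv (g (x + a)) +
    absv (f x) * (absv (p a) / absv a)))).
- have : \forall a \near (0 : D)^', a != 0 by apply: nbhs_dnbhs_neq.
  apply: filterS => a a0; rewrite divr_ge0 ?absv_ge0 //=.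
  rewrite ler_pdivrMr ?absv_gt0 //.
  apply: le_trans (ler_absvD _ _) _; rewrite mulrDl lerD //.
    by rewrite absvM absvBC mulrAC ler_wpM2r ?absv_ge0.
  apply: le_trans (ler_absvD _ _) _; rewrite mulrDl !absvM.
  rewrite mulrAC divfK ?absv_neq0 // -[in leRHS]mulrA divfK ?absv_neq0 //.
- exact: cvg_cst.
- rewrite -[X in _ --> X](addr0 0); apply: cvgD.
    rewrite -[X in _ --> X](mulr0 C); apply: cvgMr.
    exact/cvg_absvP.
  rewrite -[X in _ --> X](addr0 0); apply: cvgD.
    rewrite -[X in _ --> X](mul0r (absv (g x))); apply: cvgM => //.
    exact: cvg_absv.
  by rewrite -[X in _ --> X](mulr0 (absv (f x))); apply: cvgMr.
Qed.

End Derivative.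

(** * Polynomial maps filtered by order of vanishing at 0 *)

Section PolynomialMaps.
Context {R : realType} {D : completeDivRingType R}.
Implicit Types (f g : D -> D).

(** The index is a lower bound on the number of occurrences of the variable in
    each monomial. The inequality in [PolyMul] lets this bound be weakened,
    so that both terms of the Leibniz rule land in the same [polymap k.-1],
    also when one factor has bound [0]. *)
Inductive polymap : nat -> (D -> D) -> Prop :=
| PolyCst c : polymap 0 (fun=> c)
| PolyId : polymap 1 id
| PolyAdd k f g of polymap k f & polymap k g : polymap k (fun x => f x + g x)
| PolyMul i j k f g of polymap i f & polymap j g & (k <= i + j)%N :
    polymap k (fun x => f x * g x).

Lemma polymap_continuous k f : polymap k f -> continuous f.
Proof.
elim=> {k f} [c||k f g _ fc _ gc|i j k f g _ fc _ gc _] x.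
- exact: cvg_cst.
- exact: cvg_id.
- by apply: cvg_divringD; [exact: fc | exact: gc].
- by apply: cvg_divringM; [exact: fc | exact: gc].
Qed.

Lemma polymap_at0 k f : polymap k f -> (0 < k)%N -> f 0 = 0.
Proof.
elim=> {k f} // [k f g _ IHf _ IHg k0|i j k f g _ IHf _ IHg kij k0].
  by rewrite IHf // IHg // addr0.
have := leq_trans k0 kij; rewrite addn_gt0 => /orP[i0|j0].
  by rewrite IHf // mul0r.
by rewrite IHg // mulr0.
Qed.

(** One family [df] serves both parts of the conclusion: it is linear in the
    increment for a fixed point, and polynomial in the point for a fixed
    increment. *)
Lemma polymap_derivative k f : polymap k f -> exists df : D -> D -> D,
  (forall x, bounded_gateaux_derivative f x (df x)) /\
  forall h, polymap k.-1 (df ^~ h).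
Proof.
elim=> {k f} [c||k f g pf [df [fd pdf]] pg [dg [gd pdg]]
             |i j k f g pf [df [fd pdf]] pg [dg [gd pdg]] kij].
- exists (fun _ _ => 0); split=> [x|h]; last exact: PolyCst.
  exact: bounded_gateaux_derivative_cst.
- exists (fun _ h => h); split=> [x|h]; last exact: PolyCst.
  exact: bounded_gateaux_derivative_id.
- exists (fun x h => df x h + dg x h); split=> [x|h].
    exact: bounded_gateaux_derivativeD.
  exact: PolyAdd.
- exists (fun x h => df x h * g x + f x * dg x h); split=> [x|h].
    by apply: bounded_gateaux_derivativeM => //; exact: polymap_continuous pg.
  apply: PolyAdd.
    apply: PolyMul (pdf h) pg _.
    by case: i {pf pdf} kij => [|i]; case: k => //= k; exact: ltnW.
  apply: PolyMul pf (pdg h) _.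
  by case: j {pg pdg} kij => [|j]; case: k => //= k; rewrite ?addnS //; exact: ltnW.
Qed.

Lemma polymap_gateaux_differentiable k f :
  polymap k f -> gateaux_differentiable f.
Proof.
move=> /polymap_derivative[df [fd _]] x.
by exists (df x); case: (fd x).
Qed.

Lemma polymap_gateaux k f h :
  polymap k f -> polymap k.-1 (fun x => gateaux f x h).
Proof.
move=> /polymap_derivative[df [fd pdf]].
rewrite (_ : (fun x => _) = df ^~ h) //; apply/funext => x.
by rewrite (gateaux_eq (proj1 (fd x))).
Qed.

Lemma polymap_gateauxn hs k f :
  polymap k f -> polymap (k - size hs) (gateauxn f hs).
Proof.
elim: hs k f => [|h hs IH] k f pf /=; first by rewrite subn0.
by rewrite subnS -subn1 subnAC subn1; apply: IH; exact: polymap_gateaux.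
Qed.

Lemma polymap_monomial n (a : 'I_n.+1 -> D) : polymap n (monomial a).
Proof.
suff pprod (b : 'I_n -> D) : polymap n (fun x => \prod_(i < n) (x * b i)).
  by apply: PolyMul (PolyCst (a ord0)) (pprod _) _.
elim: n b {a} => [|n IH] b.
  rewrite (_ : (fun x => _) = fun=> 1); first exact: PolyCst.
  by apply/funext => x; rewrite big_ord0.
rewrite (_ : (fun x => _) = fun x =>
  (x * b ord0) * \prod_(i < n) (x * b (lift ord0 i))).
  apply: (@PolyMul 1 n) (IH _) _ => //.
  by apply: PolyMul PolyId (PolyCst _) _.
by apply/funext => x; rewrite big_ord_recl.
Qed.

End PolynomialMaps.

Local Close Scope classical_set_scope.

(* The first conjunct says that the derivatives occurring in the second one
   exist, so that the latter is not about the junk value of [gateaux]. *)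
Theorem theorem9p4 (R : realType) (D : completeDivRingType R) (n : nat)
    (a : 'I_n.+1 -> D) (m : nat) (hmn : (m < n)%N) :
  gateaux_differentiablen m (monomial a) /\
  forall h : D, gateauxn (monomial a) (nseq m h) 0 = 0.
Proof.
split=> [hs _|h].
  exact: polymap_gateaux_differentiable (polymap_gateauxn _ (polymap_monomial a)).
apply: polymap_at0 (polymap_gateauxn _ (polymap_monomial a)) _.
by rewrite size_nseq subn_gt0.
Qed.
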